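(* For every setting $(N,M,\boldsymbol q)$, the adaptive Boston mechanism $\mathrm{ABM}$ is weakly less varying than the Random Serial Dictatorship mechanism $\mathrm{RSD}$; that is, for any agent $i\in N$, any preference profile $(P_i,P_{-i})\in\mathcal P^N$, and any $P_i'\in N_{P_i}$, $\mathrm{RSD}_i(P_i,P_{-i})=\mathrm{RSD}_i(P_i',P_{-i})$ implies $\mathrm{ABM}_i(P_i,P_{-i})=\mathrm{ABM}_i(P_i',P_{-i})$.
   Context: A setting $(N,M,\boldsymbol q)$ consists of a finite set $N$ of $n$ agents, a finite set $M$ of $m$ objects, and a vector $\boldsymbol q=(q_j)_{j\in M}$ of capacities (positive integers; there are $q_j$ units of object $j$) with $n\le\sum_{j\in M}q_j$. $\mathcal P$ is the set of strict preference orders (linear orders) over $M$. A preference profile is an element $(P_i,P_{-i})\in\mathcal P^N$, where $P_{-i}$ are the orders of all agents except $i$. The neighborhood $N_P$ of $P\in\mathcal P$ is the set of orders obtained from $P$ by swapping two objects that are adjacent in $P$. An assignment is an $N\times M$ matrix $x$ with $x_{i,j}\in[0,1]$, $\sum_{j\in M}x_{i,j}=1$ for all $i$, and $\sum_{i\in N}x_{i,j}\le q_j$ for all $j$. A mechanism maps each preference profile to an assignment; for a mechanism $\varphi$, $\varphi_i(P_i,P_{-i})$ denotes the row (assignment vector) of agent $i$. Random Serial Dictatorship (RSD): an ordering of the agents is drawn uniformly at random from all $n!$ orderings; in this order, each agent receives the object it most prefers (according to its reported order) among the objects with remaining capacity. $\mathrm{RSD}_{i,j}(\boldsymbol P)$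 is the resulting probability that agent $i$ receives object $j$. Adaptive Boston mechanism (ABM): a single priority ordering of the agents is drawn uniformly at random from all $n!$ orderings (each agent draws a random number; the same ordering is used for all objects and all rounds). The assignment proceeds in rounds. In each round, every agent who has not yet been assigned an object applies to the object it most prefers (according to its reported order) among all objects that still have remaining capacity at the beginning of that round. If an object has at most as many applicants as remaining capacity, all its applicants are assigned to it; otherwise its remaining capacity is given to the applicants with highest priority in the ordering, and the remaining applicants continue to the next round. Assignments are final. The process ends when all agents have received an object. $\mathrm{ABM}_{i,j}(\boldsymbol P)$ is the resulting probability that agent $i$ receives object $j$. *)

(* Defs.v *)
From HB Require Import structures.
From mathcomp Require Import all_boot all_order all_algebra all_fingroup.

Set Implicit Arguments.
Unset Strict Implicit.
Unset Printing Implicit Defensive.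

Import Order.TTheory GRing.Theory Num.Theory.

Local Open Scope nat_scope.

Record setting := Setting {
  agent : finType;
  object : finType;
  capacity : object -> nat;
  capacity_gt0 : forall j, 0 < capacity j;
  capacity_enough : #|agent| <= \sum_j capacity j
}.

(* [pref_rel P a b] reads "a is strictly preferred to b". *)
Record preference (M : finType) := Preference {
  pref_rel :> rel M;
  pref_irr : irreflexive pref_rel;
  pref_trans : transitive pref_rel;
  pref_total : forall a b, a != b -> pref_rel a b || pref_rel b a
}.

Definition neighbor (M : finType) (P P' : preference M) : Prop :=
  exists a b : M,
    [/\ P a b,
        forall c, ~~ (P a c && P c b) &
        forall x y, P' x y = P (tperm a b x) (tperm a b y)].

Definition best (M : finType) (P : preference M) (A : {set M}) : option M :=
  [pick j in A | [forall k in A, (k != j) ==> P j k]].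

Section Mechanisms.
Variable S : setting.
Notation N := (agent S).
Notation M := (object S).
Notation q := (@capacity S).

Definition profile := N -> preference M.

Definition deviate (P : profile) (i : N) (Pi' : preference M) : profile :=
  fun k => if k == i then Pi' else P k.

(* Deterministic, possibly partial, allocation: [None] is "not yet assigned". *)
Definition allocation := {ffun N -> option M}.

Definition no_allocation : allocation := [ffun => None].

Definition holders (mu : allocation) (j : M) : {set N} :=
  [set k | mu k == Some j].

Definition remaining (mu : allocation) (j : M) : nat := q j - #|holders mu j|.

Definition available (mu : allocation) : {set M} :=
  [set j | 0 < remaining mu j].

(* The tuples [o] with [uniq o] are the n! orderings of the agents, listed from
   first (highest priority) to last. *)
Definition orderings : {set #|N|.-tuple N} := [set o : #|N|.-tuple N | uniq o].

Definition sd_step (P : profile) (mu : allocation) (k : N) : allocation :=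
  [ffun l => if l == k then best (P k) (available mu) else mu l].

Definition serial_dictatorship (P : profile) (o : seq N) : allocation :=
  foldl (sd_step P) no_allocation o.

Definition applicants (P : profile) (mu : allocation) (j : M) : {set N} :=
  [set k | (mu k == None) && (best (P k) (available mu) == Some j)].

(* An applicant is accepted iff fewer than [remaining mu j] applicants to the
   same object precede it in the ordering; this includes the case where the
   remaining capacity suffices for all applicants. *)
Definition accepted (P : profile) (o : seq N) (mu : allocation) (j : M) :
    {set N} :=
  [set k in applicants P mu j |
    #|[set l in applicants P mu j | index l o < index k o]| < remaining mu j].

Definition abm_round (P : profile) (o : seq N) (mu : allocation) : allocation :=
  [ffun k => if mu k is Some j then Some j
             else [pick j | k \in accepted P o mu j]].

(* While some agent is unassigned each round assigns at least one agent, and a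
   round changes nothing once all are assigned, so #|N| rounds run the process
   to its end; [adaptive_boston_total] below checks this. *)
Definition adaptive_boston (P : profile) (o : seq N) : allocation :=
  iter #|N| (abm_round P o) no_allocation.

Lemma best_in (P : preference M) (A : {set M}) j : best P A = Some j -> j \in A.
Proof. by rewrite /best; case: pickP => // k /andP[kA _] [<-]. Qed.

Lemma best_some (P : preference M) (A : {set M}) j0 : j0 \in A -> best P A != None.
Proof.
move=> j0A; rewrite /best; case: pickP => // no.
have [j jA jmax] := arg_maxnP (fun j => #|[set k | P j k]|) j0A.
have /negP[] := negbT (no j); apply/andP; split; first exact: jA.
apply/forall_inP => k kA; apply/implyP => nkj.
case/orP: (pref_total P nkj) => // Pkj.
have /= := jmax k kA; rewrite /geq /= leqNgt => /negP[]; apply: proper_card.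
apply/properP; split; first by apply/subsetP => x; rewrite !inE; apply: pref_trans.
by exists j; rewrite !inE ?Pkj // pref_irr.
Qed.

Definition within_capacity (mu : allocation) := forall j, #|holders mu j| <= q j.

Lemma card_fun_eqSome (T : finType) (A : {set T}) (f : T -> option M) :
  \sum_j #|[set k in A | f k == Some j]| = #|[set k in A | f k != None]|.
Proof.
rewrite -[RHS]sum1dep_card.
transitivity (\sum_j \sum_(k | (k \in A) && (f k == Some j)) 1).
  by apply: eq_bigr => j _; rewrite sum1dep_card.
rewrite (exchange_big_dep (fun k => (k \in A) && (f k != None))) /=; last first.
  by move=> j k _ /andP[-> /eqP->].
apply: eq_bigr => k /andP[kA]; case E: (f k) => [j|//] _.
rewrite (big_pred1 j) // => j'; rewrite kA /=.
by rewrite eq_sym; apply/eqP/eqP => [[]|->].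
Qed.

Lemma available_exists mu k : within_capacity mu -> mu k = None ->
  exists j, j \in available mu.
Proof.
move=> wc muk; case: (pickP (mem (available mu))) => [j jA|no]; first by exists j.
exfalso.
have : \sum_j q j <= \sum_j #|holders mu j|.
  apply: leq_sum => j _; have /= := no j.
  by rewrite inE /remaining subn_gt0 ltnNge => /negbFE.
have -> : \sum_j #|holders mu j| = #|[set k in [set: N] | mu k != None]|.
  by rewrite -card_fun_eqSome; apply: eq_bigr => j _; apply: eq_card => l; rewrite !inE.
move/(leq_trans (capacity_enough S)); rewrite leqNgt => /negP[].
rewrite -cardsT; apply: proper_card; rewrite properE subsetT /=.
by apply/negP => /subsetP/(_ k (in_setT _)); rewrite !inE muk.
Qed.

Lemma within_capacity0 : within_capacity no_allocation.
Proof.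
move=> j; rewrite (_ : holders _ _ = set0) ?cards0 //.
by apply/setP => k; rewrite !inE ffunE.
Qed.

Lemma sd_step_within P mu k : within_capacity mu ->
  within_capacity (sd_step P mu k).
Proof.
move=> wc j; case: (eqVneq (best (P k) (available mu)) (Some j)) => [E|nE].
  have := best_in E; rewrite inE /remaining subn_gt0; apply: leq_trans.
  apply: (@leq_trans #|k |: holders mu j|); last by rewrite cardsU1; case: (_ \notin _).
  apply/subset_leq_card/subsetP => l; rewrite !inE ffunE.
  by case: (l == k).
apply: leq_trans (wc j); apply/subset_leq_card/subsetP => l; rewrite !inE ffunE.
by case: (l == k) => //; rewrite (negbTE nE).
Qed.

Lemma sd_within P o : within_capacity (serial_dictatorship P o).
Proof.
rewrite /serial_dictatorship; elim/last_ind: o => [|o k IH] /=; first exact: within_capacity0.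
by rewrite foldl_rcons; apply: sd_step_within.
Qed.

Lemma sd_assigned P o k : uniq o -> (serial_dictatorship P o k != None) = (k \in o).
Proof.
elim/last_ind: o k => [|o k' IH] k; first by rewrite ffunE.
rewrite rcons_uniq => /andP[k'o uo]; rewrite /serial_dictatorship foldl_rcons.
rewrite -/(serial_dictatorship P o) ffunE mem_rcons inE.
case: (eqVneq k k') => [_|_] /=; last exact: IH.
have E : serial_dictatorship P o k' = None.
  by apply/eqP/negPn; rewrite IH.
have [j jA] := available_exists (sd_within P o) E.
by rewrite (best_some _ jA).
Qed.

Lemma mem_ordering (o : #|N|.-tuple N) : uniq o -> forall k, k \in o.
Proof.
move=> uo k; apply: contraT => nko.
have /card_uniqP E : uniq (k :: o) by rewrite /= nko.
by have := max_card (mem (k :: o)); rewrite E /= size_tuple ltnn.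
Qed.

Lemma serial_dictatorship_total P (o : #|N|.-tuple N) k :
  uniq o -> serial_dictatorship P o k != None.
Proof. by move=> uo; rewrite sd_assigned // mem_ordering. Qed.

Lemma card_accepted P (o : #|N|.-tuple N) mu j : uniq o ->
  #|accepted P o mu j| <= remaining mu j.
Proof.
move=> uo; case: (set_0Vmem (accepted P o mu j)) => [->|[k0 k0B]]; first by rewrite cards0.
have [k kB kmax] := arg_maxnP (fun k => index k o) k0B.
have : k \in accepted P o mu j by exact: kB.
rewrite inE => /andP[_]; apply: leq_trans.
set D := [set _ in _ | _].
apply: (@leq_trans #|k |: D|); last by rewrite cardsU1; case: (_ \notin _).
apply/subset_leq_card/subsetP => l lB; rewrite inE in_set1.
case: eqVneq => //= nlk; rewrite inE.
have := lB; rewrite inE => /andP[-> _] /=.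
rewrite ltn_neqAle (kmax _ lB : is_true (_ <= _)) andbT; apply: contraNneq nlk => E.
by rewrite -(nth_index k (mem_ordering uo l)) E nth_index // mem_ordering.
Qed.

Lemma abm_round_within P (o : #|N|.-tuple N) mu : uniq o ->
  within_capacity mu -> within_capacity (abm_round P o mu).
Proof.
move=> uo wc j; apply: (@leq_trans #|holders mu j :|: accepted P o mu j|).
  apply/subset_leq_card/subsetP => k; rewrite in_setU inE ffunE [k \in holders _ _]inE.
  case E: (mu k) => [j'|]; first by move=> ->.
  by case: pickP => // j' kj' /eqP[<-]; rewrite kj' orbT.
apply: (leq_trans (leq_card_setU _ _)).
by rewrite -leq_subRL ?card_accepted.
Qed.

Lemma abm_within P (o : #|N|.-tuple N) r : uniq o ->
  within_capacity (iter r (abm_round P o) no_allocation).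
Proof.
move=> uo; elim: r => [|r IH] /=; first exact: within_capacity0.
exact: abm_round_within.
Qed.

Lemma abm_round_progress P (o : #|N|.-tuple N) mu k0 : within_capacity mu ->
  mu k0 = None -> exists k, mu k = None /\ abm_round P o mu k != None.
Proof.
move=> wc E0; have [j0 j0A] := available_exists wc E0.
case E: (best (P k0) (available mu)) (best_some (P k0) j0A) => [j|] // _.
have k0A : k0 \in applicants P mu j by rewrite inE E0 E !eqxx.
have [k kA' kmin] := arg_minnP (fun k => index k o) k0A.
have {kA'} kA : k \in applicants P mu j by exact: kA'.
have muk : mu k = None by move: kA; rewrite inE => /andP[/eqP].
exists k; split=> //; rewrite ffunE muk; case: pickP => // /(_ j).
move: kA; rewrite [_ \in accepted _ _ _ _]inE => -> /=.
rewrite (_ : [set _ in _ | _] = set0) ?cards0.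
  by have := best_in E; rewrite inE => ->.
apply/setP => l; rewrite inE in_set0; apply/andP=> -[lA].
by rewrite ltnNge (kmin _ lA).
Qed.

Lemma abm_count P (o : #|N|.-tuple N) r : uniq o ->
  minn r #|N| <= #|[set k | iter r (abm_round P o) no_allocation k != None]|.
Proof.
move=> uo; elim: r => [|r IH]; first by rewrite min0n.
set mu := iter r _ _ in IH *; rewrite iterS -/mu.
have sub : [set k | mu k != None] \subset [set k | abm_round P o mu k != None].
  by apply/subsetP => k; rewrite !inE ffunE; case: (mu k).
case: (pickP (fun k => mu k == None)) => [k /eqP muk|all].
  have [l [mul rl]] := abm_round_progress P o (abm_within P r uo) muk.
  have : #|[set k | mu k != None]| < #|[set k | abm_round P o mu k != None]|.
    apply: proper_card; apply/properP; split=> //.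
    by exists l; rewrite !inE ?rl // mul.
  apply: leq_trans; move: IH; rewrite -ltnS; apply: leq_trans.
  by rewrite -minnSS leq_min geq_minl /= (leq_trans (geq_minr _ _)).
apply: leq_trans (geq_minr _ _) _; apply: leq_trans (subset_leq_card sub).
by rewrite -cardsT; apply/subset_leq_card/subsetP => k _; rewrite inE all.
Qed.

Lemma adaptive_boston_total P (o : #|N|.-tuple N) k :
  uniq o -> adaptive_boston P o k != None.
Proof.
move=> uo; have le := abm_count P #|N| uo; rewrite minnn in le.
have /eqP E : [set k | adaptive_boston P o k != None] == [set: N].
  by rewrite eqEcard subsetT cardsT.
by have := in_setT k; rewrite -E inE.
Qed.

Lemma card_orderings : #|orderings| = #|N|`!.
Proof.
rewrite -ffactnn -(card_uniq_tuples #|N| (fun=> true)).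
apply: eq_card => o; rewrite !inE; apply/esym/andb_idl => _.
exact/allP.
Qed.

Section Scalars.
Variable R : realFieldType.
Local Open Scope ring_scope.

Definition is_assignment (x : N -> M -> R) : Prop :=
  [/\ forall i j, 0 <= x i j <= 1,
      forall i, \sum_j x i j = 1 &
      forall j, \sum_i x i j <= (q j)%:R].

Record mechanism := Mechanism {
  mech :> profile -> N -> M -> R;
  mech_assignment : forall P, is_assignment (mech P)
}.

(* psi is weakly less varying than phi. *)
Definition weakly_less_varying (psi phi : mechanism) : Prop :=
  forall (i : N) (P : profile) (Pi' : preference M),
    neighbor (P i) Pi' ->
    (forall j, phi P i j = phi (deviate P i Pi') i j) ->
    (forall j, psi P i j = psi (deviate P i Pi') i j).

(* Probability that i receives j when the ordering is uniform. *)
Definition lottery (f : #|N|.-tuple N -> allocation) (i : N) (j : M) : R :=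
  #|[set o in orderings | f o i == Some j]|%:R / (#|N|`!)%:R.

Lemma lottery_assignment (f : #|N|.-tuple N -> allocation) :
  (forall o : #|N|.-tuple N, uniq o -> within_capacity (f o)) ->
  (forall (o : #|N|.-tuple N) i, uniq o -> f o i != None) ->
  is_assignment (lottery f).
Proof.
move=> wc tot.
have n0 : (0 < (#|N|`!)%:R :> R) by rewrite ltr0n fact_gt0.
split=> [i j|i|j].
- rewrite /lottery divr_ge0 ?ler0n //= ler_pdivrMr // mul1r ler_nat.
  rewrite -card_orderings; apply/subset_leq_card/subsetP => o.
  by rewrite inE => /andP[].
- rewrite -mulr_suml -natr_sum card_fun_eqSome.
  rewrite (_ : [set _ in _ | _] = orderings) ?card_orderings ?divff ?gt_eqF //.
  apply/setP => o; rewrite inE; apply: andb_idr; rewrite inE; exact: tot.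
- rewrite -mulr_suml ler_pdivrMr // -natr_sum -natrM ler_nat.
  rewrite -card_orderings mulnC.
  have -> : (\sum_i #|[set o in orderings | f o i == Some j]| =
             \sum_(o in orderings) #|holders (f o) j|)%N.
    transitivity (\sum_i \sum_(o | (o \in orderings) && (f o i == Some j)) 1)%N.
      by apply: eq_bigr => i _; rewrite sum1dep_card.
    rewrite (exchange_big_dep (mem orderings)) /=; last by move=> i o _ /andP[].
    apply: eq_bigr => o oO; rewrite -sum1dep_card.
    by apply: eq_bigl => i; rewrite oO.
  rewrite -sum_nat_const; apply: leq_sum => o; rewrite inE => uo; exact: wc.
Qed.

Definition RSD : mechanism :=
  @Mechanism (fun P => lottery (serial_dictatorship P))
    (fun P => @lottery_assignment (serial_dictatorship P)
       (fun o _ => sd_within P o)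
       (fun o i uo => serial_dictatorship_total P i uo)).

Definition ABM : mechanism :=
  @Mechanism (fun P => lottery (adaptive_boston P))
    (fun P => @lottery_assignment (adaptive_boston P)
       (fun o uo => abm_within P #|N| uo)
       (fun o i uo => adaptive_boston_total P i uo)).

End Scalars.
End Mechanisms.

(* Main.v *)
Require Import Defs.
From mathcomp Require Import all_boot all_order all_algebra.
From mathcomp Require Import all_fingroup.

(** Let [P i] and [Pi'] differ by the adjacent objects a, b with a preferred in
[P i]. In RSD, for each ordering the deviation changes the object of i only from
a to b, so RSD_{i,a} can stay the same only if no ordering lets i choose first
from a set whose two choices differ. Every partial allocation reached by ABM
after some rounds is reached by serial dictatorship too: let the agents choose
round by round, in any order within a round. Each finds its ABM object left, and
it was already the best one at the beginning of the round. So if i's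
applications differed in some round, putting i right after the agents assigned
before that round would give an excluded ordering. *)

Set Implicit Arguments.
Unset Strict Implicit.
Unset Printing Implicit Defensive.

Import Order.TTheory GRing.Theory Num.Theory.

Lemma bestP (M : finType) (P : preference M) (A : {set M}) j :
  best P A = Some j <-> j \in A /\ {in A, forall k, k != j -> P j k}.
Proof.
rewrite /best; case: pickP => [x /andP[xA /forall_inP xmax]|no].
  split=> [[<-]|[jA jmax]].
    by split=> // k kA; apply/implyP/xmax.
  congr Some; apply/eqP/contraT => nxj.
  have Pxj := implyP (xmax _ jA); rewrite eq_sym in Pxj.
  have := pref_trans (Pxj nxj) (jmax _ xA nxj).
  by rewrite pref_irr.
split=> // -[jA jmax]; have := no j; rewrite jA /= => /forall_inP[].
by move=> k kA; apply/implyP/jmax.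
Qed.

Lemma best_subset (M : finType) (P : preference M) (A B : {set M}) j :
  B \subset A -> j \in B -> best P A = Some j -> best P B = Some j.
Proof.
move=> /subsetP sBA jB /bestP[_ jmax]; apply/bestP.
by split=> // k /sBA; apply: jmax.
Qed.

(** The swap reverses a single comparison, so a choice can change only where [a] is best and [b] is
    also on offer. *)
Lemma best_neighbor (S : setting) (P P' : preference (object S)) :
  neighbor P P' ->
  exists a b, a != b /\ forall A, best P A = best P' A \/
    best P A = Some a /\ best P' A = Some b.
Proof.
case=> a [b [Pab adj swap]].
have nab : a != b by apply: contraTneq Pab => ->; rewrite pref_irr.
exists a, b; split=> // A.
have Pba : P b a = false.
  by apply/negP => Pba; have := pref_trans Pab Pba; rewrite pref_irr.
(* By adjacency, any third object lies on the same side of [a] and [b]. *)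
have Pac c : c != a -> c != b -> P a c = P b c.
  move=> nca ncb; apply/idP/idP => [Pac|]; last exact: pref_trans Pab.
  by case/orP: (pref_total P ncb) => // Pcb; have := adj c; rewrite Pac Pcb.
have Pca c : c != a -> c != b -> P c a = P c b.
  move=> nca ncb; apply/idP/idP => [/pref_trans/(_ Pab)//|Pcb].
  by case/orP: (pref_total P nca) => // Pac'; have := adj c; rewrite Pac' Pcb.
have P'sub x y : (x != a) || (y != b) -> P x y -> P' x y.
  rewrite swap; case: (tpermP a b x) => [->|->|/eqP nxa /eqP nxb];
    case: (tpermP a b y) => [->|->|/eqP nya /eqP nyb];
    rewrite ?eqxx ?pref_irr ?Pba //= => _.
  - by rewrite Pac.
  - by rewrite Pac.
  - by rewrite Pca.
  - by rewrite Pca.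
case E: (best P A) => [x|]; last first.
  left; case E': (best P' A) => [y|] //.
  by have := best_some P (best_in E'); rewrite E.
move/bestP: E => [xA xmax].
(* Outside this case, no comparison that makes [x] best in [A] is that of [a] over [b], so [P'sub]
   preserves them all. *)
have [/andP[/eqP xa bA]|nxab] := boolP ((x == a) && (b \in A)).
  right; rewrite -xa; split=> //; apply/bestP; split=> // k kA nkb.
  have [->|nka] := eqVneq k a; first by rewrite swap tpermL tpermR.
  by apply: P'sub; rewrite 1?eq_sym ?nab // -Pac // -xa xmax // xa.
left; symmetry; apply/bestP; split=> // k kA nkx.
apply: P'sub; last exact: xmax.
by apply: contraR nxab; rewrite negb_or !negbK => /andP[-> /eqP <-].
Qed.

Section ABMversusRSD.
Variable S : setting.
Notation N := (agent S).
Notation M := (object S).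

Lemma sd_fold_notin (P : profile S) mu t k :
  k \notin t -> foldl (sd_step P) mu t k = mu k.
Proof.
elim/last_ind: t => [|t l IH] //; rewrite mem_rcons inE negb_or => /andP[nkl nkt].
by rewrite foldl_rcons ffunE (negbTE nkl) IH.
Qed.

Lemma sd_fold_deviate (P : profile S) i Q mu t : i \notin t ->
  foldl (sd_step (deviate P i Q)) mu t = foldl (sd_step P) mu t.
Proof.
elim/last_ind: t => [|t l IH] //; rewrite mem_rcons inE negb_or => /andP[nil nit].
rewrite !foldl_rcons IH //; apply/ffunP => k; rewrite !ffunE /deviate.
by rewrite [l == i]eq_sym (negbTE nil).
Qed.

Lemma sd_pivot (P : profile S) s i t : i \notin t ->
  serial_dictatorship P (s ++ i :: t) i =
  best (P i) (available (serial_dictatorship P s)).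
Proof.
by move=> nit; rewrite /serial_dictatorship foldl_cat /= sd_fold_notin // ffunE eqxx.
Qed.

Lemma available_sub (mu nu : allocation S) :
  (forall k, mu k != None -> nu k = mu k) -> available nu \subset available mu.
Proof.
move=> ext; apply/subsetP => j; rewrite !inE => /leq_trans; apply.
apply: leq_sub2l; apply/subset_leq_card/subsetP => k; rewrite !inE => /eqP muk.
by rewrite ext muk.
Qed.

Lemma abm_round_assigned (P : profile S) o (mu : allocation S) k j :
  mu k = None -> abm_round P o mu k = Some j ->
  best (P k) (available mu) = Some j.
Proof.
move=> muk; rewrite ffunE muk; case: pickP => // x kx [<-].
by move: kx; rewrite !inE => /andP[/andP[_ /eqP]].
Qed.

(** The order of [t] is immaterial: within one round, the agents already served never exhaust an
    object that the round still gives to a later one. *)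
Lemma sd_fold_abm_round (P : profile S) (o : #|N|.-tuple N) (mu : allocation S) t :
  uniq o -> within_capacity mu -> uniq t ->
  {in t, forall k, mu k = None /\ abm_round P o mu k != None} ->
  foldl (sd_step P) mu t =
    [ffun k => if k \in t then abm_round P o mu k else mu k].
Proof.
move=> uo wc; set mu' := abm_round P o mu.
elim/last_ind: t => [|t k IH] /=; first by move=> _ _; apply/ffunP => k; rewrite ffunE.
rewrite rcons_uniq foldl_rcons => /andP[nkt ut] new.
rewrite IH //; last by move=> l lt; apply: new; rewrite mem_rcons inE lt orbT.
set nu := (X in sd_step _ X _).
have [muk] := new k ltac:(by rewrite mem_rcons inE eqxx).
case E: (mu' k) => [j|] // _.
have bj := abm_round_assigned muk E.
(* The full round respects capacity, and [k] holds [j] after it but not yet in [nu]; hence a unit of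
   [j] is left. *)
have jnu : j \in available nu.
  rewrite inE /remaining subn_gt0.
  apply: leq_trans (abm_round_within P uo wc j); apply: proper_card.
  apply/properP; split; last by exists k; rewrite !inE ?E ?eqxx // [nu k]ffunE (negbTE nkt) muk.
  apply/subsetP => l; rewrite !inE [nu l]ffunE; case: (l \in t) => // /eqP mul.
  by rewrite [mu' l]ffunE mul.
have sub : available nu \subset available mu.
  apply: available_sub => l mul; rewrite ffunE; case: ifP => // lt.
  by have [mulN] := new l ltac:(by rewrite mem_rcons inE lt orbT); rewrite mulN in mul.
apply/ffunP => l; rewrite [LHS]ffunE [RHS]ffunE mem_rcons inE.
have [->|_] /= := eqVneq l k; last by rewrite ffunE.
by rewrite E; apply: best_subset bj.
Qed.

Lemma abm_reached_by_sd (P : profile S) (o : #|N|.-tuple N) r : uniq o ->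
  exists s : seq N, uniq s /\
    serial_dictatorship P s = iter r (abm_round P o) (no_allocation S).
Proof.
move=> uo; elim: r => [|r [s [us sdE]]]; first by exists [::].
have wc := abm_within P r uo; rewrite iterS; move: sdE wc.
set mu := iter r _ _ => sdE wc.
pose t := enum [set k | (mu k == None) && (abm_round P o mu k != None)].
have tE k : (k \in t) = (mu k == None) && (abm_round P o mu k != None).
  by rewrite mem_enum inE.
exists (s ++ t); split.
  rewrite cat_uniq us enum_uniq andbT /=; apply/hasPn => k.
  by rewrite tE -(sd_assigned P k us) sdE => /andP[-> _].
rewrite /serial_dictatorship foldl_cat -/(serial_dictatorship P s) sdE.
rewrite (sd_fold_abm_round uo wc) ?enum_uniq //; last first.
  by move=> k; rewrite tE => /andP[/eqP].
apply/ffunP => k; rewrite ffunE tE; case E: (mu k) => [j|] /=.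
  by rewrite ffunE E.
by case: eqVneq.
Qed.

(** Turns a partial run into a complete ordering, which the lottery draws with positive probability,
    where [i] moves right after [s]. *)
Lemma uniq_extend_ordering (s : seq N) (i : N) : uniq s -> i \notin s ->
  exists2 o : #|N|.-tuple N, uniq o &
    exists2 t, i \notin t & (o : seq N) = s ++ i :: t.
Proof.
move=> us nis; pose t := enum [set k | k \notin i :: s].
have it : i \notin t by rewrite mem_enum !inE eqxx.
have uo : uniq (s ++ i :: t).
  rewrite cat_uniq us cons_uniq it enum_uniq /= andbT negb_or nis /=.
  by apply/hasPn => k; rewrite mem_enum !inE negb_or => /andP[].
have so : size (s ++ i :: t) == #|N|.
  rewrite -(card_uniqP uo) -cardsT; apply/eqP/eq_card => k.
  rewrite in_setT mem_cat inE mem_enum !inE.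
  by case: (k == i); case: (k \in s).
by exists (Tuple so) => //; exists t.
Qed.

(** A round sees preferences only through the current applications, and an assigned agent does not
    apply. *)
Lemma abm_round_deviate (P : profile S) i Q o (mu : allocation S) :
  (mu i = None -> best (P i) (available mu) = best Q (available mu)) ->
  abm_round (deviate P i Q) o mu = abm_round P o mu.
Proof.
move=> same.
have appE j : applicants (deviate P i Q) mu j = applicants P mu j.
  apply/setP => k; rewrite !inE /deviate.
  by have [->|] := eqVneq k i; case: (mu _ =P None) => //= /same ->.
apply/ffunP => k; rewrite !ffunE; case: (mu k) => //.
by apply: eq_pick => j; rewrite /accepted appE.
Qed.

Lemma sd_ordering_split (o : #|N|.-tuple N) (i : N) : uniq o ->
  exists s t, [/\ i \notin s, i \notin t & (o : seq N) = s ++ i :: t].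
Proof.
move=> uo; have := mem_ordering uo i; move: uo => /[swap].
case/splitPr => s t; rewrite cat_uniq /= negb_or => /and4P[_ /andP[nis _] nit _].
by exists s, t.
Qed.

Lemma eq_lottery (R : realFieldType) (f g : #|N|.-tuple N -> allocation S) i j :
  (forall o : #|N|.-tuple N, uniq o -> f o = g o) ->
  lottery R f i j = lottery R g i j.
Proof.
move=> eqfg; rewrite /lottery.
suff -> : [set o in orderings S | f o i == Some j] =
          [set o in orderings S | g o i == Some j] by [].
by apply/setP => o; rewrite !inE; case: (boolP (uniq o)) => //= uo; rewrite eqfg.
Qed.

Lemma RSD_invariant_best (R : realFieldType) (P : profile S) i Q s :
  neighbor (P i) Q ->
  (forall j, RSD S R P i j = RSD S R (deviate P i Q) i j) ->
  uniq s -> i \notin s ->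
  best (P i) (available (serial_dictatorship P s)) =
  best Q (available (serial_dictatorship P s)).
Proof.
move=> /best_neighbor[a [b [nab swap]]] /(_ a) /= eqa us nis.
case: (swap (available (serial_dictatorship P s))) => // -[bP bQ].
have devi : deviate P i Q i = Q by rewrite /deviate eqxx.
set P' := deviate P i Q in eqa devi.
pose X p := [set o in orderings S | serial_dictatorship p (o : #|N|.-tuple N) i == Some a].
have n0 : (#|N|`!%:R : R)%R != 0%R by rewrite pnatr_eq0 -lt0n fact_gt0.
have cardX : #|X P| = #|X P'|.
  move: eqa; rewrite /lottery => /(congr1 (fun x => x * #|N|`!%:R)%R).
  rewrite !divfK // => /eqP; rewrite eqr_nat => /eqP //.
(* Agents before [i] choose alike in both profiles, and the deviation never turns another object
   into [a]. *)
have subX : X P' \subset X P.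
  apply/subsetP => o; rewrite !inE => /andP[uo]; rewrite uo /=.
  have [s' [t' [nis' nit' ->]]] := sd_ordering_split i uo.
  rewrite !sd_pivot // devi /serial_dictatorship sd_fold_deviate //.
  rewrite -/(serial_dictatorship P s').
  case: (swap (available (serial_dictatorship P s'))) => [->//|[_ ->]].
  by move=> /eqP[ba]; rewrite ba eqxx in nab.
have /eqP EX : X P' == X P by rewrite eqEcard subX cardX /=.
(* This ordering gives [i] the object [a] under [P] but [b] under [P'], against the equality of the
   two sets. *)
have [o uo [t nit oE]] := uniq_extend_ordering us nis.
have : o \in X P by rewrite !inE uo oE sd_pivot // bP eqxx.
rewrite -EX !inE uo oE sd_pivot // devi /serial_dictatorship sd_fold_deviate //.
rewrite -/(serial_dictatorship P s) bQ /= => /eqP[ba].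
by rewrite ba eqxx in nab.
Qed.

End ABMversusRSD.

Theorem theorem4 (R : realFieldType) (S : setting) :
  weakly_less_varying (ABM S R) (RSD S R).
Proof.
move=> i P Q nbr eqRSD j.
apply: eq_lottery => o uo; symmetry; rewrite /adaptive_boston.
suff it r : iter r (abm_round (deviate P i Q) o) (no_allocation S) =
            iter r (abm_round P o) (no_allocation S) by exact: it.
elim: r => [//|r IH]; rewrite !iterS IH.
apply: abm_round_deviate; have [s [us <-]] := abm_reached_by_sd P r uo.
(* Being unassigned, [i] is not among the agents of [s]. *)
move=> sdi; apply: (RSD_invariant_best nbr eqRSD us).
by rewrite -(sd_assigned P i us) sdi.
Qed.
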